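(* For every integer $r\ge 3$ and every $\gamma>0$ there exist $\varepsilon>0$ and $n_0\in\mathbb{N}$ such that for every graph $G$ on $n\ge n_0$ vertices the following is true. If \[ \phi(G,K_r)\ge \mathrm{ex}(n,K_r)-\varepsilon n^2, \] then there exists a partition $V(G)=V_1\,\dot\cup\,\cdots\,\dot\cup\, V_{r-1}$ with $\sum_{i=1}^{r-1}e(V_i)<\gamma n^2$.
   Context: All graphs are finite and simple. For graphs $G$ and $H$, an $H$-decomposition of $G$ is a partition of $E(G)$ into parts $G_1,\dots,G_t$ such that each $G_i$ is either a single edge or is isomorphic to $H$; $\phi(G,H)$ denotes the smallest possible $t$. Equivalently $\phi(G,H)=e(G)-(e(H)-1)N(G,H)$, where $N(G,H)$ is the maximum number of pairwise edge-disjoint copies of $H$ in $G$. $\mathrm{ex}(n,H)$ is the maximum number of edges in a graph on $n$ vertices that does not contain $H$ as a (not necessarily induced) subgraph. For $U\subseteq V(G)$, $e(U)$ is the number of edges of $G$ with both endpoints in $U$. *)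

(* Defs.v *)
From HB Require Import structures.
From mathcomp Require Import all_boot.

Set Implicit Arguments.
Unset Strict Implicit.
Unset Printing Implicit Defensive.

(* A finite simple graph on the vertex set T is given by its edge set, a set of
   2-element subsets of T; loops and multiple edges are excluded by the encoding. *)
Record sgraph (T : finType) := SGraph {
  edges :> {set {set T}};
  edges_card2 : [forall A in edges, #|A| == 2]
}.

HB.instance Definition _ (T : finType) := [isSub for @edges T].
HB.instance Definition _ (T : finType) := [Finite of sgraph T by <:].

Lemma complete_subproof (r : nat) :
  [forall A in [set A : {set 'I_r} | #|A| == 2], #|A| == 2].
Proof. by apply/forall_inP => A; rewrite inE. Qed.

Definition complete (r : nat) : sgraph 'I_r := SGraph (complete_subproof r).

(* A set D of edges on T is a copy of H when it is the image of the edge set of H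
   under an injective map of vertices.  Isolated vertices of H leave no trace in D
   but still need room in T. *)
Definition is_copy (U T : finType) (H : sgraph U) (D : {set {set T}}) : bool :=
  [exists f : {ffun U -> T}, injectiveb f && (D == [set f @: A | A : {set U} in edges H])].

Definition contains (U T : finType) (H : sgraph U) (G : sgraph T) : bool :=
  [exists D : {set {set T}}, (D \subset edges G) && is_copy H D].

Definition decomposition (U T : finType) (H : sgraph U) (G : sgraph T)
    (P : {set {set {set T}}}) : bool :=
  partition P (edges G) && [forall D in P, (#|D| == 1) || is_copy H D].

Definition has_decomposition (U T : finType) (H : sgraph U) (G : sgraph T) : pred nat :=
  fun t => [exists P : {set {set {set T}}}, decomposition H G P && (#|P| == t)].

Lemma has_decomposition_ex (U T : finType) (H : sgraph U) (G : sgraph T) :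
  exists t, has_decomposition H G t.
Proof.
pose P := [set [set A] | A in edges G].
exists #|P|; apply/existsP; exists P; rewrite eqxx andbT; apply/andP; split.
  apply/and3P; split.
  - apply/eqP/setP => A; apply/bigcupP/idP => [[D /imsetP[B GB ->]]|GA].
      by rewrite inE => /eqP ->.
    by exists [set A]; rewrite ?inE // imset_f.
  - apply/trivIsetP => D1 D2 /imsetP[A _ ->] /imsetP[B _ ->] neAB.
    by rewrite disjoints1 inE; apply: contraNneq neAB => ->.
  - by apply/imsetP => -[A _ /setP/(_ A)]; rewrite !inE eqxx.
by apply/forall_inP => D /imsetP[A _ ->]; rewrite cards1.
Qed.

Definition phi (U T : finType) (G : sgraph T) (H : sgraph U) : nat :=
  ex_minn (has_decomposition_ex H G).

(* 0 if no graph on n vertices is H-free, i.e. if H has no edges and at most n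
   vertices. *)
Definition extremal_number (n : nat) (U : finType) (H : sgraph U) : nat :=
  \max_(G : sgraph 'I_n | ~~ contains H G) #|edges G|.

Definition edges_in (T : finType) (G : sgraph T) (U : {set T}) : nat :=
  #|[set A in edges G | A \subset U]|.

(* Main.v *)
(** Let e = e(G), let N be the number of r-cliques in a maximum edge-disjoint family,
    and let t = (1 - 1/(r-1)) n^2 / 2, so that phi(G, K_r) <= e - (C(r,2) - 1) N.

    The key estimate is (1 + c)(e - t) <= (C(r,2) - 1) N + O(n) for some c = c(r) > 0.  As
    in Bollobas' proof of phi(G, K_r) <= ex(n, K_r), remove a vertex x of minimum degree
    together with r-cliques through x that come from disjoint (r-1)-cliques in the
    neighbourhood of x.  If deg x exceeds (1 - 1/(r-1)) n by m, there are at least m - 1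
    such cliques, and each pays for r - 2 edges at x; for r >= 4 this leaves a surplus.
    For r = 3 it only breaks even, so a matching of size about min(2m, deg x / 2) is used
    instead; this is wasteful only when G is nearly complete, and then the triples
    x + y + z = 0 in Z/n give directly about n^2 / 6 edge-disjoint triangles.

    If phi(G, K_r) >= t - o(n^2), the estimate forces e <= t + o(n^2) and N = o(n^2).
    Deleting a saturated packing therefore leaves a K_r-free graph with t - o(n^2) edges,
    and Furedi's form of the stability theorem (split off the non-neighbours of a vertex
    of maximum degree, recurse into its neighbourhood) yields the partition. *)
Require Import Defs.
From mathcomp Require Import all_boot all_order all_algebra.
From mathcomp Require Import reals.
From mathcomp Require Import zify ring lra.
Import Order.TTheory GRing.Theory Num.Theory.

Set Implicit Arguments.
Unset Strict Implicit.
Unset Printing Implicit Defensive.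

(** * Edge sets and clique packings *)

Section EdgeSets.

Variable T : finType.
Implicit Types (F G L : {set {set T}}) (K S U A : {set T}).

Definition pairs K : {set {set T}} := [set A : {set T} | A \subset K & #|A| == 2].

(** [F] may be any family of sets; the test [x != y] keeps a singleton in [F] from acting as a loop,
    so [nbr] is always irreflexive. *)
Definition nbr F (x : T) : {set T} := [set y | (x != y) && ([set x; y] \in F)].

Lemma card_pairs K : #|pairs K| = 'C(#|K|, 2).
Proof. exact: cards_draws. Qed.

Lemma pair_in_pairs (x y : T) K : x != y -> x \in K -> y \in K -> [set x; y] \in pairs K.
Proof. by move=> nxy xK yK; rewrite inE cards2 nxy subUset !sub1set xK yK. Qed.

Lemma pairsP A K :
  reflect (exists x y, [/\ A = [set x; y], x != y, x \in K & y \in K]) (A \in pairs K).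
Proof.
apply: (iffP idP) => [|[x [y [-> nxy xK yK]]]]; last exact: pair_in_pairs.
rewrite inE => /andP[sAK /cards2P[x [y [nxy eA]]]]; exists x, y; split=> //.
  by apply: (subsetP sAK); rewrite eA !inE eqxx.
by apply: (subsetP sAK); rewrite eA !inE eqxx orbT.
Qed.

Lemma nbr_sym F x y : (y \in nbr F x) = (x \in nbr F y).
Proof. by rewrite !inE eq_sym setUC. Qed.

Lemma nbr_irr F x : x \notin nbr F x.
Proof. by rewrite inE eqxx. Qed.

Lemma nbr_sub F S x : F \subset pairs S -> nbr F x \subset S.
Proof.
move=> /subsetP FS; apply/subsetP => y; rewrite inE => /andP[_ /FS].
by rewrite inE subUset !sub1set => /andP[/andP[]].
Qed.

Lemma cliqueP F K :
  reflect (forall x y, x \in K -> y \in K -> x != y -> y \in nbr F x) (pairs K \subset F).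
Proof.
apply: (iffP subsetP) => [KF x y xK yK nxy|KF A /pairsP[x [y [-> nxy xK yK]]]].
  by rewrite inE nxy KF // pair_in_pairs.
by have := KF _ _ xK yK nxy; rewrite inE => /andP[].
Qed.

Lemma clique_add F K x :
  pairs K \subset F -> K \subset nbr F x -> pairs (x |: K) \subset F.
Proof.
move=> /cliqueP KF /subsetP Kx; apply/cliqueP => u v.
rewrite !inE => /predU1P[->|uK] /predU1P[->|vK].
- by rewrite eqxx.
- by move=> _; have := Kx _ vK; rewrite inE.
- by move=> _; have := Kx _ uK; rewrite nbr_sym inE.
- by move=> /(KF _ _ uK vK); rewrite inE.
Qed.

Lemma card_star F x : (forall A, A \in F -> #|A| = 2) ->
  #|[set A in F | x \in A]| = #|nbr F x|.
Proof.
move=> F2; rewrite -(card_in_imset (f := fun y => [set x; y])).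
  apply: eq_card => A; rewrite inE; apply/andP/imsetP => [[AF xA]|[y]].
    have /eqP/cards2P[u [v [nuv eA]]] := F2 _ AF.
    move: xA; rewrite eA !inE => /orP[/eqP ->|/eqP ->].
      by exists v => //; rewrite inE nuv -eA.
    by exists u; rewrite ?inE 1?eq_sym ?nuv -1?setUC -?eA // setUC.
  by rewrite inE => /andP[nxy xyF ->]; rewrite !inE eqxx.
move=> y z; rewrite !inE => /andP[nxy _] /andP[nxz _] /setP/(_ y).
by rewrite !inE eqxx orbT eq_sym (negPf nxy) /= => /esym/eqP.
Qed.

Lemma handshake F : (forall A, A \in F -> #|A| = 2) ->
  \sum_x #|nbr F x| = #|F|.*2.
Proof.
move=> F2; under eq_bigr => x _ do rewrite -card_star // -sum1_card.
under eq_bigr => x _.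
  under eq_bigl => A do rewrite inE.
  rewrite big_mkcondr. over.
rewrite exchange_big /= -muln2 -sum_nat_const; apply: eq_bigr => A AF.
by rewrite -[RHS](F2 _ AF) -sum1_card [RHS]big_mkcond.
Qed.

Lemma sum_nbr_in F U : (forall A, A \in F -> #|A| = 2) ->
  \sum_(x in U) #|nbr F x :&: U| = #|[set A in F | A \subset U]|.*2.
Proof.
move=> F2; rewrite -handshake => [|A]; last by rewrite inE => /andP[/F2].
rewrite big_mkcond; apply: eq_bigr => x _; case: ifP => xU.
  by apply: eq_card => y; rewrite !inE subUset !sub1set xU /= andbA.
apply/esym/eqP; rewrite cards_eq0; apply/eqP/setP => y.
by rewrite !inE subUset !sub1set xU !andbF.
Qed.

Section Packing.

Variable r : nat.

(** The cliques are removed one after another, which builds in edge-disjointness; [L] is what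
    remains of [F]. *)
Inductive pack : {set {set T}} -> nat -> {set {set T}} -> Prop :=
| pack0 F : pack F 0 F
| packS F K k L : #|K| = r -> pairs K \subset F -> pack (F :\: pairs K) k L ->
    pack F k.+1 L.

Definition packable F k := exists L, pack F k L.

Lemma pack_card F k L : pack F k L -> #|F| = #|L| + 'C(r, 2) * k.
Proof.
elim=> {F k L} [F|F K k L Kr KF _ IH]; first by rewrite muln0 addn0.
by rewrite -(cardsID (pairs K) F) IH (setIidPr KF) card_pairs Kr; lia.
Qed.

Lemma pack_sub F k L : pack F k L -> L \subset F.
Proof.
elim=> {F k L} // F K k L _ _ _ IH; apply: subset_trans IH _; exact: subsetDl.
Qed.

Lemma pack_rcons F k L K : pack F k L -> #|K| = r -> pairs K \subset L ->
  pack F k.+1 (L :\: pairs K).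
Proof.
move=> + Kr; elim=> {F k L} [F KF|F K' k L K'r K'F _ IH KL].
  by apply: packS KF _ => //; exact: pack0.
by apply: packS K'F _ => //; exact: IH.
Qed.

Lemma packableS F F' k : F \subset F' -> packable F k -> packable F' k.
Proof.
move=> + [L FL]; elim: FL F' => {F k L} [F F' _|F K k L Kr KF _ IH F' sF].
  by exists F'; exact: pack0.
have [|L' pL'] := IH (F' :\: pairs K); first exact: setSD.
by exists L'; apply: packS pL' => //; exact: subset_trans sF.
Qed.

Lemma pack_saturate F k L : 1 < r -> pack F k L -> exists k' L',
  [/\ pack F k' L', k <= k' & forall K, #|K| = r -> ~~ (pairs K \subset L')].
Proof.
move=> r1; have [m] := ubnP #|L|; elim: m k L => // m IH k L Lm FL.
have [/existsP[K /andP[/eqP Kr KL]]|noK] :=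
  boolP [exists K : {set T}, (#|K| == r) && (pairs K \subset L)].
  have [|k' [L' [FL' kk' noK]]] := IH _ _ _ (pack_rcons FL Kr KL).
    have := cardsID (pairs K) L; rewrite (setIidPr KL) card_pairs Kr.
    by rewrite -bin_gt0 in r1; lia.
  by exists k', L'; split=> //; lia.
exists k, L; split=> // K Kr; apply: contra noK => KL.
by apply/existsP; exists K; rewrite Kr eqxx.
Qed.

End Packing.
End EdgeSets.

(** * Decompositions from packings, and stability of clique-free graphs *)

Section Decomp.
Variable T : finType.
Implicit Types (F G L : {set {set T}}) (K S U A : {set T}).

Lemma copy_complete_card r (D : {set {set T}}) : is_copy (complete r) D ->
  exists2 K : {set T}, #|K| = r & D = pairs K.
Proof.
case/existsP => f /andP[/injectiveP injf /eqP ->].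
exists (f @: setT); first by rewrite card_imset // cardsT card_ord.
apply/setP => A; apply/imsetP/pairsP => [[B]|[x [y [-> nxy /imsetP[i _ ex] /imsetP[j _ ey]]]]].
  rewrite inE => /cards2P[i [j [nij ->]]] ->; exists (f i), (f j).
  by rewrite imsetU1 imset_set1 (inj_eq injf) nij !imset_f.
move: nxy; rewrite {}ex {}ey (inj_eq injf) => nij.
by exists [set i; j]; rewrite ?inE ?cards2 ?nij // imsetU1 imset_set1.
Qed.

Lemma is_copy_pairs K : is_copy (complete #|K|) (pairs K).
Proof.
apply/existsP; exists [ffun i => enum_val i]; apply/andP; split.
  by apply/injectiveP => i j; rewrite !ffunE => /enum_val_inj.
apply/eqP/setP => A; apply/pairsP/imsetP => [[x [y [-> nxy xK yK]]]|[B]].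
  exists [set enum_rank_in xK x; enum_rank_in xK y].
    by rewrite inE cards2 -(inj_eq enum_val_inj) !enum_rankK_in // nxy.
  by rewrite imsetU1 imset_set1 !ffunE !enum_rankK_in.
rewrite inE => /cards2P[i [j [nij ->]]] ->; exists (enum_val i), (enum_val j).
by rewrite imsetU1 imset_set1 !ffunE (inj_eq enum_val_inj) nij !enum_valP.
Qed.

Lemma pack_decomp r F k L : 1 < r -> pack r F k L -> exists P,
  [/\ partition P F, [forall D in P, (#|D| == 1) || is_copy (complete r) D]
    & #|P| <= #|L| + k].
Proof.
move=> r1; elim=> {F k L} [F|F K k L Kr KF _ [P [partP copyP leP]]].
  exists [set [set A] | A in F]; split; last first.
  - by rewrite addn0 leq_imset_card.
  - by apply/forall_inP => D /imsetP[A _ ->]; rewrite cards1.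
  apply/and3P; split.
  - apply/eqP/setP => A; apply/bigcupP/idP => [[D /imsetP[B GB ->]]|GA].
      by rewrite inE => /eqP ->.
    by exists [set A]; rewrite ?inE // imset_f.
  - apply/trivIsetP => D1 D2 /imsetP[A _ ->] /imsetP[B _ ->] neAB.
    by rewrite disjoints1 inE; apply: contraNneq neAB => ->.
  - by apply/imsetP => -[A _ /setP/(_ A)]; rewrite !inE eqxx.
exists (pairs K |: P); split.
- rewrite -(setID F (pairs K)) (setIidPr KF) partitionU1 //.
    by rewrite -card_gt0 card_pairs Kr bin_gt0.
  by rewrite disjoint_sym disjoints_subset subsetDr.
- apply/forall_inP => D; case/setU1P=> [->|]; last exact: (forall_inP copyP).
  by rewrite -Kr is_copy_pairs orbT.
- by rewrite cardsU1 addnS -add1n leq_add ?leq_b1.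
Qed.

Lemma phi_le_pack r (G : sgraph T) k L : 1 < r -> pack r (edges G) k L ->
  phi G (complete r) <= #|L| + k.
Proof.
move=> r1 /(pack_decomp r1)[P [partP copyP leP]].
apply: leq_trans leP; rewrite /phi; case: ex_minnP => t _; apply.
by apply/existsP; exists P; rewrite eqxx andbT; apply/andP.
Qed.

(** Each monochromatic edge inside [S] is seen from both ends, so this is twice their number. *)
Definition mono L S (f : T -> nat) : nat :=
  \sum_(x in S) #|[set y in nbr L x :&: S | f y == f x]|.

(** Arithmetic of one recursion step: [d] and [v] are the sizes of the neighbourhood and of the
    rest, [W] and [W2] the degree sums inside them, [W1] the number of edges between them. After
    multiplying by q+1, the slack is the square of d - (q+1) v. *)
Lemma coloring_step q d v M W W1 W2 :
  q.+1 * (W + M) <= q * d ^ 2 -> W1 + W2 <= v * d ->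
  q.+2 * (W + W1 + (W1 + W2) + (M + W2)) <= q.+1 * (d + v) ^ 2.
Proof.
move=> IH H; rewrite -(@leq_pmul2l q.+1) //.
have H1 : q.+2 * (q.+1 * (W + M)) <= q.+2 * (q * d ^ 2) by rewrite leq_mul2l IH orbT.
have H2 : 2 * q.+1 * q.+2 * (W1 + W2) <= 2 * q.+1 * q.+2 * (v * d).
  by rewrite leq_mul2l H orbT.
have [H3 _] := nat_Cauchy d (q.+1 * v).
by rewrite -!mulnn in H1 H3 *; lia.
Qed.

(** Edges are counted twice in both sums, so the bound is e + m <= (1 - 1/(p+1)) |S|^2 / 2 with m
    monochromatic edges. The neighbourhood of a vertex of maximum degree has no (p+1)-clique and is
    coloured recursively; its complement in [S] becomes one new class. *)
Lemma clique_coloring L p S :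
  (forall K, K \subset S -> #|K| = p.+2 -> ~~ (pairs K \subset L)) ->
  exists f : T -> nat, (forall x, x \in S -> f x <= p) /\
    p.+1 * (\sum_(x in S) #|nbr L x :&: S| + mono L S f) <= p * #|S| ^ 2.
Proof.
elim: p S => [|q IH] S noK.
  exists (fun=> 0); split=> //.
  have H x : x \in S -> nbr L x :&: S = set0.
    move=> xS; apply/setP => y; rewrite !inE; apply/negP => /andP[/andP[nxy xyL] yS].
    apply: (negP (noK [set x; y] _ _)).
    - by rewrite subUset !sub1set xS.
    - by rewrite cards2 nxy.
    apply/subsetP => A; rewrite inE => /andP[sA /eqP A2].
    suff -> : A = [set x; y] by [].
    by apply/eqP; rewrite eqEcard sA A2 cards2 nxy.
  rewrite mul1n mul0n leqn0 addn_eq0 !sum_nat_eq0; apply/andP; split.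
    by apply/forall_inP => x /H ->; rewrite cards0.
  apply/forall_inP => x xS; rewrite cards_eq0 -subset0; apply/subsetP => y.
  by rewrite inE H // inE.
have [->|[x0 x0S]] := set_0Vmem S.
  by exists (fun=> 0); split=> [x|]; rewrite ?inE // /mono !big_set0 muln0.
pose deg x := #|nbr L x :&: S|.
have [x xS xmax] := arg_maxnP deg x0S; have {}xS : x \in S := xS.
pose S' := nbr L x :&: S; pose V := S :\: nbr L x.
have [|f [fp IHf]] := IH S'.
  move=> K KS' Kq; have /subsetIP[Kx KS] := KS'.
  apply: contra (noK (x |: K) _ _) => [KL||].
  - exact: clique_add.
  - by rewrite subUset sub1set xS.
  rewrite cardsU1 Kq (contra (subsetP Kx x)) // nbr_irr //.
(* Recursive colours are at most [q], so the colour [q.+1] is fresh and no edge between [V] and [S']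
   is monochromatic. *)
pose g y := if y \in nbr L x then f y else q.+1.
exists g; split=> [y yS|].
  rewrite /g; case: ifP => // yx; apply: leqW; apply: fp; by rewrite inE yx.
have SE (h : T -> nat) : \sum_(y in S) h y = \sum_(y in S') h y + \sum_(y in V) h y.
  rewrite (bigID (mem (nbr L x))) /=; congr (_ + _); apply: eq_bigl => y; rewrite !inE /=; lia.
have degE y : #|nbr L y :&: S| = #|nbr L y :&: S'| + #|nbr L y :&: V|.
  rewrite -(cardsID (nbr L x) (nbr L y :&: S)); congr (_ + _).
    by apply: eq_card => z; rewrite !inE; lia.
  by apply: eq_card => z; rewrite !inE; lia.
have swap : \sum_(y in S') #|nbr L y :&: V| = \sum_(y in V) #|nbr L y :&: S'|.
  have cardE y A : #|nbr L y :&: A| = \sum_(z in A) (z \in nbr L y).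
    rewrite -sum1_card -big_mkcondl; apply: eq_bigl => z; by rewrite inE.
  under eq_bigr do rewrite cardE.
  rewrite exchange_big /=; apply: eq_bigr => y _; rewrite cardE.
  by apply: eq_bigr => z _; rewrite nbr_sym.
have monoE : mono L S g = mono L S' f + \sum_(y in V) #|nbr L y :&: V|.
  rewrite /mono SE; congr (_ + _); apply: eq_bigr => y.
    rewrite in_setI => /andP[yx yS]; apply: eq_card => z; rewrite /g inE [RHS]inE !in_setI yx.
    have := fp y; rewrite in_setI yx yS => /(_ isT) fy.
    have nq : (q.+1 == f y) = false by apply/eqP => eq; rewrite -eq ltnn in fy.
    by case: (z \in nbr L x); rewrite /= ?nq ?andbF.
  rewrite in_setD => /andP[/negPf yx yS]; apply: eq_card => z; rewrite /g inE !in_setI in_setD yx.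
  case zx: (z \in nbr L x); last by rewrite eqxx andbT.
  case zS: (z \in S); rewrite /= ?andbF //.
  have := fp z; rewrite in_setI zx zS => /(_ isT) fz; apply/negP => /andP[_ /eqP]; lia.
(* Maximality of the degree of [x], which is |S'|, summed over [V]. *)
have degV : \sum_(y in V) (#|nbr L y :&: S'| + #|nbr L y :&: V|) <= #|V| * #|S'|.
  rewrite -sum_nat_const; apply: leq_sum => y; rewrite inE => /andP[_ yS].
  by rewrite -degE; exact: xmax.
have cS : #|S| = #|S'| + #|V|.
  rewrite -(cardsID (nbr L x) S); congr (_ + _); by rewrite setIC.
rewrite big_split /= in degV.
under eq_bigr do rewrite degE.
rewrite SE !big_split /= swap monoE cS.
exact: coloring_step IHf degV.
Qed.

End Decomp.

(** * The Turan graph, and cliques through a vertex *)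

Lemma card_mod_class n p (i : 'I_n) :
  0 < p -> #|[set j : 'I_n | i == j %[mod p]]| <= n %/ p + 1.
Proof.
move=> p0; rewrite addn1 -[leqRHS]card_ord.
rewrite -(card_in_imset (f := fun j : 'I_n => inord (j %/ p) : 'I_(n %/ p).+1)).
  exact: max_card.
move=> j k; rewrite !inE => /eqP ij /eqP ik /(congr1 val).
have lt (l : 'I_n) : l %/ p < (n %/ p).+1 by rewrite ltnS leq_div2r // ltnW.
rewrite /= !inordK // => e; apply: val_inj => /=.
by rewrite (divn_eq j p) (divn_eq k p) e -ij -ik.
Qed.

(** The witness joins numbers in different residue classes mod [p]. A vertex misses at most n/p + 1
    vertices, itself included; the rounding term 1 costs the summand [p * n]. *)
Lemma turan_lower n p : 0 < p ->
  p.-1 * n ^ 2 <= p * (extremal_number n (complete p.+1)).*2 + p * n.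
Proof.
case: p => // q _.
pose E := [set A in pairs [set: 'I_n] |
            ~~ [forall i in A, forall j in A, i == j %[mod q.+1]]].
have E2 A : A \in E -> #|A| = 2 by rewrite !inE => /andP[/andP[_ /eqP]].
have E2' : [forall A in E, #|A| == 2] by apply/forall_inP => A /E2 ->.
have EP x y : y \in nbr E x -> x != y %[mod q.+1].
  rewrite 2!inE => /andP[nxy /andP[_]]; apply: contra => /eqP exy.
  apply/forall_inP => i; rewrite !inE => /orP[] /eqP->; apply/forall_inP => j;
  by rewrite !inE => /orP[] /eqP->; rewrite ?exy.
have nbrE x : nbr E x = ~: [set y : 'I_n | x == y %[mod q.+1]].
  apply/setP => y; rewrite in_setC [in RHS]inE.
  apply/idP/idP => [yx|nxy]; first exact: EP.
  have nxy' : x != y by apply: contraNneq nxy => ->.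
  rewrite inE nxy' inE pair_in_pairs // ?inE //; apply: contra nxy => /forall_inP H.
  by apply: (forall_inP (H x _) y); rewrite !inE eqxx ?orbT.
have : #|E| <= extremal_number n (complete q.+2).
  apply: (@leq_bigmax_cond _ _ _ (SGraph E2')); apply/existsP => -[D /andP[/= DE]].
  move=> /copy_complete_card[K Kq DK]; move: DE; rewrite DK => /cliqueP KE.
  suff : #|K| <= #|'I_q.+1| by rewrite Kq card_ord ltnn.
  rewrite -(card_in_imset (f := fun x : 'I_n => inord (x %% q.+1) : 'I_q.+1)).
    exact: max_card.
  move=> x y xK yK /(congr1 val); rewrite /= !inordK ?ltn_pmod // => exy.
  by apply/eqP; apply/negPn/negP => /(KE _ _ xK yK) /EP; rewrite exy eqxx.
rewrite -leq_double -(handshake E2) => H.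
have {H} : n * (n - (n %/ q.+1).+1) <= (extremal_number n (complete q.+2)).*2.
  apply: leq_trans H; rewrite -{1}(card_ord n) -sum_nat_const; apply: leq_sum => x _.
  rewrite nbrE cardsCs setCK card_ord leq_sub2l // (leq_trans (card_mod_class _ _)) ?addn1 //.
move: ((extremal_number _ _).*2) => e; have := leq_trunc_div n q.+1; move: (n %/ q.+1) => m /= mq H.
have : q.+1 * (n * (n - m.+1)) <= q.+1 * e by rewrite leq_mul2l H orbT.
have : n * n <= n * (n - m.+1) + n * m.+1 by rewrite -mulnDr leq_mul2l; lia.
have : n * (m * q.+1) <= n * n by rewrite leq_mul2l mq orbT.
by rewrite -mulnn; nia.
Qed.

Section Star.
Variable T : finType.
Implicit Types (F G L : {set {set T}}) (K S U A : {set T}).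

(** The cliques [x |: K] meet pairwise only in [x], hence share no edge. An edge of [G] avoids [x]
    and lies in no [K], so it lies in none of them. *)
Lemma packable_star r x (s : seq {set T}) F G k :
  pairwise (fun K K' => [disjoint K & K']) s ->
  (forall K, K \in s -> [/\ #|K| = r, K \subset nbr F x & pairs K \subset F]) ->
  G \subset F ->
  (forall A, A \in G -> x \notin A /\ forall K, K \in s -> ~~ (A \subset K)) ->
  (forall A, A \in F -> #|A| = 2) -> 1 < r ->
  packable r.+1 G k -> packable r.+1 F (size s + k).
Proof.
elim: s F => [|K s IH] F /=; first by move=> _ _ GF _ _ _; exact: packableS.
move=> /andP[/allP Ks pws] sF GF GA F2 r1 Gk.
have [Kr Kx KF] := sF K (mem_head _ _).
have xK : x \notin K by apply: contra (nbr_irr F x); exact: (subsetP Kx).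
have sub : pairs (x |: K) \subset F by apply: clique_add.
have [||||L pL] := IH (F :\: pairs (x |: K)) pws _ _ _ _ r1 Gk.
- move=> K' K's; have [K'r K'x K'F] := sF K' (mem_behead (s := K :: s) K's).
  have dK : [disjoint K' & K] by rewrite disjoint_sym Ks.
  have notin y : y \in K' -> y \notin x |: K.
    move=> yK'; rewrite !inE negb_or (disjointFr dK) // andbT.
    by have := subsetP K'x _ yK'; rewrite inE eq_sym => /andP[].
  have notpair A y : y \in K' -> y \in A -> A \notin pairs (x |: K).
    move=> yK' yA; rewrite inE negb_and; apply/orP; left; apply: contra (notin _ yK').
    by move=> /subsetP/(_ _ yA).
  split=> //; apply/subsetP.
    move=> y yK'; have := subsetP K'x _ yK'; rewrite inE => /andP[nxy xyF].
    by rewrite inE nxy in_setD xyF andbT; exact: notpair yK' (set22 x y).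
  move=> A AK'; rewrite in_setD (subsetP K'F) // andbT.
  have /pairsP[y [z [-> _ yK' _]]] := AK'.
  by apply: notpair yK' _; rewrite !inE eqxx.
- apply/subsetP => A AG; rewrite in_setD (subsetP GF) // andbT.
  have [xA sA] := GA A AG; apply/negP; rewrite inE => /andP[/subsetP AxK _].
  have /negP := sA K (mem_head _ _); apply; apply/subsetP => y yA.
  have := AxK _ yA; rewrite !inE => /predU1P[eyx|//].
  by rewrite -eyx yA in xA.
- move=> A /GA[xA sA]; split=> // K' K's; apply: sA; exact: mem_behead.
- by move=> A /setDP[/F2].
exists L; apply: packS pL => //; by rewrite cardsU1 xK Kr.
Qed.

(** All edges at [x] are dropped, also those in no clique, so that the induction can continue on the
    remaining vertices. *)
Definition away F x (s : seq {set T}) :=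
  [set A in F | (x \notin A) && all (fun K => ~~ (A \subset K)) s].

Lemma card_away r F x s : (forall A, A \in F -> #|A| = 2) ->
  (forall K, K \in s -> #|K| = r) ->
  #|F| <= #|away F x s| + #|nbr F x| + size s * 'C(r, 2).
Proof.
move=> F2 sr.
have : F \subset away F x s :|: [set A in F | x \in A] :|: \bigcup_(K <- s) pairs K.
  apply/subsetP => A AF; rewrite !in_setU !in_set AF /=.
  case: (boolP (x \in A)) => //= _; rewrite orbF; case: allP => //= nall.
  have [K Ks AK] : exists2 K, K \in s & A \subset K.
    have [/hasP[K] |/hasPn H] := boolP (has (fun K => A \subset K) s).
      by exists K.
    by case: nall => K Ks; exact: H.
  by rewrite bigcup_seq; apply/bigcupP; exists K => //; rewrite inE AK F2 ?eqxx.
move/subset_leq_card/leq_trans; apply.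
apply: leq_trans (leq_card_setU _ _) _; apply: leq_add.
  by rewrite -(card_star x F2); exact: leq_card_setU.
elim: s sr {F2} => [|K s IH] sr; first by rewrite big_nil cards0.
rewrite big_cons mulSn; apply: leq_trans (leq_card_setU _ _) _; apply: leq_add.
  by rewrite card_pairs sr // mem_head.
by apply: IH => K' K's; apply: sr; exact: mem_behead.
Qed.

Lemma pack_step r F S x s k : F \subset pairs S -> 1 < r ->
  pairwise (fun K K' => [disjoint K & K']) s ->
  (forall K, K \in s -> [/\ #|K| = r, K \subset nbr F x & pairs K \subset F]) ->
  packable r.+1 (away F x s) k -> packable r.+1 F (size s + k).
Proof.
move=> FS r1 pws sF; apply: (@packable_star r x s F (away F x s)) => //.
- by apply/subsetP => A; rewrite inE => /andP[].
- by move=> A; rewrite inE => /andP[_ /andP[xA /allP sA]].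
- by move=> A AF; have := subsetP FS _ AF; rewrite inE => /andP[_ /eqP].
Qed.

End Star.

(** * Disjoint cliques in a dense set *)

Section Cliques.
Variable T : finType.
Implicit Types (F G L : {set {set T}}) (K S U A : {set T}).

(** Each chosen vertex excludes at most [b] vertices, itself included, so [s] choices leave a
    candidate for the last one. *)
Lemma greedy_clique F b s U :
  (forall v, v \in U -> #|U :\: nbr F v| <= b) -> s * b < #|U| ->
  exists K, [/\ K \subset U, #|K| = s.+1 & pairs K \subset F].
Proof.
elim: s U => [|s IH] U Ub sU.
  have [v vU] : exists v, v \in U by apply/card_gt0P; apply: leq_ltn_trans sU.
  exists [set v]; rewrite sub1set vU cards1; split=> //.
  by apply/cliqueP => x y; rewrite !inE => /eqP-> /eqP->; rewrite eqxx.
have [v vU] : exists v, v \in U by apply/card_gt0P; apply: leq_ltn_trans sU.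
have [||K [/subsetIP[KU Kv] Ks KF]] := IH (U :&: nbr F v).
- move=> w /setIP[wU _]; apply: leq_trans (Ub w wU); apply: subset_leq_card.
  by apply: setSD; exact: subsetIl.
- have := Ub v vU; have := cardsID (nbr F v) U; rewrite mulSn in sU; lia.
exists (v |: K); rewrite subUset sub1set vU KU clique_add //; split=> //.
by rewrite cardsU1 Ks (contra (subsetP Kv v)) ?nbr_irr.
Qed.

(** Before the last clique is chosen, (j-1)(s+1) vertices are used up; the hypothesis, written
    without subtraction, leaves more than s b. *)
Lemma greedy_cliques F b s j U :
  (forall v, v \in U -> #|U :\: nbr F v| <= b) -> j * s.+1 + s * b < #|U| + s.+1 ->
  exists l : seq {set T}, [/\ size l = j,
    pairwise (fun K K' => [disjoint K & K']) l &
    forall K, K \in l -> [/\ #|K| = s.+1, K \subset U & pairs K \subset F]].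
Proof.
elim: j U => [|j IH] U Ub jU; first by exists [::].
have [|K [KU Ks KF]] := greedy_clique (s := s) Ub; first by lia.
have [||l [lj pwl lU]] := IH (U :\: K).
- move=> v /setDP[vU _]; apply: leq_trans (Ub v vU); apply: subset_leq_card.
  by apply: setSD; exact: subsetDl.
- by have := cardsID K U; rewrite (setIidPr KU) Ks; lia.
exists (K :: l); split=> /=; first by rewrite lj.
- rewrite pwl andbT; apply/allP => K' /lU[_ + _].
  by rewrite subsetD disjoint_sym => /andP[].
- move=> K'; rewrite inE => /predU1P[->//|/lU[-> + ->]].
  by rewrite subsetD => /andP[-> _].
Qed.

(** Augmentation: two unmatched vertices [u], [v] either have an unmatched neighbour, giving a new
    edge, or some matching edge can be exchanged for two edges, one at [u] and one at [v]. *)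
Lemma matching F U delta j :
  (forall v, v \in U -> delta <= #|U :&: nbr F v|) -> j <= delta -> j.*2 <= #|U| ->
  exists l : seq {set T}, [/\ size l = j,
    pairwise (fun K K' => [disjoint K & K']) l &
    forall K, K \in l -> [/\ #|K| = 2, K \subset U & pairs K \subset F]].
Proof.
move=> Ud; elim: j => [|j IH] jd jU; first by exists [::].
have [||l [lj pwl lU]] := IH; [exact: ltnW | lia |].
pose V := \bigcup_(K <- l) K.
have inV K y : K \in l -> y \in K -> y \in V.
  by move=> Kl yK; rewrite /V bigcup_seq; apply/bigcupP; exists K.
have cardV A : #|A :&: V| <= \sum_(K <- l) #|A :&: K|.
  rewrite /V; elim: (l) => [|K l' IHl]; first by rewrite !big_nil setI0 cards0.
  by rewrite !big_cons setIUr; apply: leq_trans (leq_card_setU _ _) _; rewrite leq_add2l.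
have edgeP u w : u \in U -> w \in U -> w \in nbr F u ->
    [/\ #|[set u; w]| = 2, [set u; w] \subset U & pairs [set u; w] \subset F].
  move=> uU wU uw; have := uw; rewrite inE => /andP[nuw _].
  rewrite cards2 nuw subUset !sub1set uU wU; split=> //.
  apply/cliqueP => x y; rewrite !in_set2.
  by move=> /orP[]/eqP-> /orP[]/eqP->; rewrite ?eqxx // nbr_sym.
have dV K A : K \in l -> (forall y, y \in A -> y \notin V) -> [disjoint A & K].
  move=> Kl AV; rewrite disjoints_subset; apply/subsetP => y /AV; rewrite inE.
  by apply: contra; exact: inV.
have [u [v [/setDP[uU uV] /setDP[vU vV] nuv]]] :
    exists u v, [/\ u \in U :\: V, v \in U :\: V & u != v].
  apply/card_gt1P; have := cardsID V U; have := cardV U.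
  have : \sum_(K <- l) #|U :&: K| <= \sum_(K <- l) 2.
    rewrite big_seq [leqRHS]big_seq; apply: leq_sum => K /lU[<- _ _].
    by rewrite subset_leq_card // subsetIr.
  rewrite big_const_seq count_predT iter_addn_0 lj; lia.
have [/existsP[w /andP[/setDP[wU wV] uvw]]|noadj] :=
  boolP [exists w, (w \in U :\: V) && ((w \in nbr F u) || (w \in nbr F v))].
  have [u' [u'U u'V u'w]] : exists u', [/\ u' \in U, u' \notin V & w \in nbr F u'].
    by case/orP: uvw => ?; [exists u | exists v].
  exists ([set u'; w] :: l); split; first by rewrite /= lj.
  - rewrite /= pwl andbT; apply/allP => K Kl; apply: dV Kl _ => y.
    by rewrite !inE => /orP[]/eqP->.
  - by move=> K; rewrite inE => /predU1P[->|/lU//]; exact: edgeP.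
have degV y : y \in U -> (y == u) || (y == v) -> delta <= \sum_(K <- l) #|nbr F y :&: K|.
  move=> yU yuv; apply: leq_trans (cardV _); apply: leq_trans (Ud y yU) _.
  apply: subset_leq_card; apply/subsetP => w /setIP[wU yw]; rewrite inE yw /=.
  apply: contraNT noadj => wV; apply/existsP; exists w; rewrite in_setD wU wV /=.
  by case/orP: yuv => /eqP<-; rewrite yw ?orbT.
(* [u] and [v] each send at least [delta], more than [j], edges to the [j] matching edges, so some
   matching edge receives at least three of them. *)
have [/hasP[K Kl K3]|/hasPn K2] :=
  boolP (has (fun K => 2 < #|nbr F u :&: K| + #|nbr F v :&: K|) l); last first.
  have : \sum_(K <- l) (#|nbr F u :&: K| + #|nbr F v :&: K|) <= \sum_(K <- l) 2.
    by rewrite big_seq [leqRHS]big_seq; apply: leq_sum => K /K2; rewrite -leqNgt.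
  rewrite big_split big_const_seq count_predT iter_addn_0 lj /=.
  have := degV u uU; have := degV v vU; rewrite !eqxx orbT => /(_ isT) + /(_ isT).
  lia.
have [a [b [aK bK nab ua vb]]] : exists a b,
    [/\ a \in K, b \in K, a != b, a \in nbr F u & b \in nbr F v].
  have [K2 _ _] := lU K Kl.
  have le2 y : #|nbr F y :&: K| <= 2 by rewrite -K2 subset_leq_card // subsetIr.
  have [u2|u1] := ltnP 1 #|nbr F u :&: K|.
    have [b /setIP[vb bK]] : exists b, b \in nbr F v :&: K.
      by apply/card_gt0P; have := le2 u; lia.
    have [a [a' [/setIP[ua aK] /setIP[ua' a'K] naa']]] := card_gt1P u2.
    have [eab|nab] := eqVneq a b; last by exists a, b.
    by exists a', b; split; rewrite // -eab eq_sym.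
  have v2 : 1 < #|nbr F v :&: K| by have := le2 u; lia.
  have [a /setIP[ua aK]] : exists a, a \in nbr F u :&: K.
    by apply/card_gt0P; have := le2 v; lia.
  have [b [b' [/setIP[vb bK] /setIP[vb' b'K] nbb']]] := card_gt1P v2.
  have [eab|nab] := eqVneq a b; last by exists a, b.
  by exists a, b'; split; rewrite // eab.
have KU y : y \in K -> y \in U by have [_ /subsetP KU _] := lU K Kl; exact: KU.
have nV y : y \in K -> (y != u) && (y != v).
  by move=> /(inV K _ Kl) yV; apply/andP; split; apply: contraTneq yV => ->.
case/splitPr: {+}l / Kl lj pwl lU inV dV => l1 l2 lj pwl lU inV dV.
move: pwl; rewrite pairwise_cat allrel_consr /= => /and4P[/andP[/allP K1 al12] pw1 /allP K2 pw2].
have disjK K' : K' \in l1 ++ l2 -> [disjoint K & K'].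
  by rewrite mem_cat => /orP[/K1|/K2//]; rewrite disjoint_sym.
have inl K' : K' \in l1 ++ l2 -> K' \in l1 ++ K :: l2.
  by rewrite !mem_cat inE => /orP[] ->; rewrite ?orbT.
have disj y w K' : y \in U -> y \notin V -> w \in K -> K' \in l1 ++ l2 ->
    [disjoint [set y; w] & K'].
  move=> yU yV wK K'l; rewrite disjoints_subset subUset !sub1set !inE.
  rewrite (disjointFr (disjK _ K'l) wK) andbT.
  by apply: contra yV; exact: (inV _ _ (inl _ K'l)).
(* The augmenting path u a b v: the edge [K] is replaced by ua and vb. *)
exists [:: [set u; a], [set v; b] & l1 ++ l2]; split=> /=.
- by rewrite size_cat /= addnS in lj; rewrite size_cat lj.
- rewrite pairwise_cat al12 pw1 pw2 /= ?andbT -?andbA; apply/and3P; split.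
  + rewrite disjoints_subset subUset !sub1set !inE !negb_or nuv nab.
    have /andP[_ ->] := nV a aK; have /andP[+ _] := nV b bK.
    by rewrite eq_sym => ->.
  + by apply/allP => K' /disj; apply.
  + by apply/allP => K' /disj; apply.
- move=> K'; rewrite !inE => /predU1P[->|/predU1P[->|/inl/lU//]].
  + by apply: edgeP => //; exact: KU.
  + by apply: edgeP => //; exact: KU.
Qed.

End Cliques.

(** * Triangle packings of nearly complete graphs *)

Section NearComplete.
Variable T : finType.
Implicit Types (F G L : {set {set T}}) (K S U A : {set T}).

Lemma packable_family r F (l : seq {set T}) :
  uniq l -> (forall K, K \in l -> #|K| = r /\ pairs K \subset F) ->
  {in l &, forall K K', K != K' -> [disjoint pairs K & pairs K']} ->
  packable r F (size l).
Proof.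
elim: l F => [|K l IH] F /=; first by exists F; exact: pack0.
move=> /andP[Kl ul] lF dl; have [Kr KF] := lF K (mem_head _ _).
have [||L pL] := IH (F :\: pairs K) ul; last by exists L; exact: packS pL.
- move=> K' K'l; have [-> K'F] := lF K' (mem_behead (s := K :: l) K'l).
  split=> //; rewrite subsetD K'F dl ?mem_head ?inE ?K'l ?orbT //.
  by apply: contraNneq Kl => <-.
- by move=> K1 K2 K1l K2l; apply: dl; rewrite inE ?K1l ?K2l orbT.
Qed.

(* Identifying S with Z/n, op x y is the z such that x + y + z = 0. *)
Lemma zero_sum_op S x0 : x0 \in S -> exists op : T -> T -> T,
  [/\ {in S &, forall x y, op x y \in S}, (forall x y, op x y = op y x)
    & {in S &, forall x y, op x (op x y) = y}].
Proof.
move=> x0S; case eS: #|S| => [|m].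
  by have := card_gt0P; have := cards0_eq eS => S0; rewrite S0 inE in x0S.
pose f x : 'I_m.+1 := cast_ord eS (enum_rank_in x0S x).
pose g (i : 'I_m.+1) : T := enum_val (cast_ord (esym eS) i).
have fK : {in S, cancel f g} by move=> x xS; rewrite /g /f cast_ordK enum_rankK_in.
have gK : cancel g f by move=> i; rewrite /g /f enum_valK_in cast_ordKV.
exists (fun x y => g (- (f x + f y))%R); split=> [x y _ _|x y|x y xS yS].
- exact: enum_valP.
- by rewrite addrC.
- by rewrite gK opprD opprK addrA addNr add0r fK.
Qed.

(** An ordered pair (x, y) gives a triangle with [op x y] unless one of the three pairs is a
    non-edge or degenerate; each of these three failures occurs at most |S| b times. A triangle
    arises from at most 6 ordered pairs. *)
Lemma near_complete F S b : F \subset pairs S ->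
  (forall v, v \in S -> #|S :\: nbr F v| <= b) ->
  exists2 k, packable 3 F k & #|S| ^ 2 <= 6 * k + 3 * (#|S| * b).
Proof.
move=> FS Sb; have [->|[x0 x0S]] := set_0Vmem S.
  by exists 0; [exists F; exact: pack0 | rewrite cards0].
have [op [opS opC opK]] := zero_sum_op x0S.
have inX (A B : {set T}) p : (p \in setX A B) = (p.1 \in A) && (p.2 \in B).
  by case: p => x y; rewrite in_setX.
pose N := nbr F.
pose G := [set p in setX S S | [&& p.2 \in N p.1, op p.1 p.2 \in N p.1 & op p.1 p.2 \in N p.2]].
pose tri (p : T * T) := [set p.1; p.2; op p.1 p.2].
pose P := tri @: G.
have inG p : p \in G -> [/\ p.1 \in S, p.2 \in S, p.2 \in N p.1, op p.1 p.2 \in N p.1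
    & op p.1 p.2 \in N p.2].
  by rewrite inE inX => /andP[/andP[-> ->] /and3P[-> -> ->]].
have neN x y : y \in N x -> (x == y) = false by rewrite inE => /andP[/negPf].
(* Any two vertices of a triple determine the third through [op], so distinct triples share no
   edge. *)
have triE p u v : p \in G -> u \in tri p -> v \in tri p -> u != v ->
    tri p = [set u; v; op u v].
  move=> /inG[xS yS _ _ _]; rewrite /tri; move: p.1 p.2 xS yS => x y xS yS.
  have e1 := opK _ _ xS yS; have e2 : op y (op x y) = x by rewrite (opC x) opK.
  rewrite !inE -!orbA => /or3P[]/eqP-> /or3P[]/eqP->; rewrite ?eqxx // => _;
    rewrite ?(opC (op x y)) ?e1 ?e2 ?(opC y x); apply/setP => w; rewrite !inE;
    by case: (w == x); case: (w == y); case: (w == op x y).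
have tri3 p : p \in G -> #|tri p| = 3.
  move=> /inG[_ _ xy xz yz]; rewrite /tri setUC cardsU1 cards2 !inE.
  by rewrite !(eq_sym (op _ _)) (neN _ _ xz) (neN _ _ yz) (neN _ _ xy).
have triF p : p \in G -> pairs (tri p) \subset F.
  move=> /inG[_ _ xy xz yz]; apply/cliqueP => u v up vp.
  rewrite /tri !inE -!orbA in up vp.
  by case/or3P: up => /eqP->; case/or3P: vp => /eqP->; rewrite ?eqxx // => _; rewrite nbr_sym.
have GP : #|G| <= 6 * #|P|.
  rewrite -sum1_card (partition_big_imset tri) /= -/P mulnC -sum_nat_const.
  apply: leq_sum => K KP; rewrite sum1_card.
  have K3 : #|K| = 3 by have /imsetP[p pG ->] := KP; exact: tri3.
  apply: (@leq_trans #|setX K K :\: [set (x, x) | x in K]|).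
    apply: subset_leq_card; apply/subsetP => p /andP[pG /eqP <-].
    have [_ _ xy _ _] := inG p pG.
    rewrite in_setD inX /tri !inE !eqxx !orbT andbT /=.
    by apply/imsetP => -[x _ ep]; move: xy; rewrite ep (negPf (nbr_irr F x)).
  rewrite cardsD (setIidPr _) ?cardsX ?card_imset ?K3 //; first by move=> x y [].
  by apply/subsetP => _ /imsetP[x xK ->]; rewrite inX xK.
pose B := [set p in setX S S | p.2 \notin N p.1].
have leB : #|B| <= #|S| * b.
  rewrite -sum_nat_const -sum1_card.
  rewrite (eq_bigl (fun p => (p.1 \in S) && (p.2 \in S :\: N p.1))); last first.
    by move=> p; rewrite inE inX in_setD -andbA; congr (_ && _); rewrite andbC.
  rewrite -(pair_big_dep (mem S) (fun x y => y \in S :\: N x) (fun _ _ => 1)) /=.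
  by apply: leq_sum => x xS; rewrite sum1_card; exact: Sb.
(* The map (x, y) to (x, op x y) is injective because [op x] is an involution, and it sends [B2]
   into [B]; [B3] is treated in the same way. *)
pose B2 := [set p in setX S S | op p.1 p.2 \notin N p.1].
have leB2 : #|B2| <= #|B|.
  rewrite -(card_in_imset (f := fun p => (p.1, op p.1 p.2))).
    apply: subset_leq_card; apply/subsetP => _ /imsetP[p + ->].
    rewrite inE inX => /andP[/andP[xS yS] xz].
    by rewrite inE inX /= xS opS.
  move=> [x y] [x' y']; rewrite inE inX => /andP[/andP[/= xS yS] _].
  rewrite inE inX => /andP[/andP[/= x'S y'S] _] [ex]; rewrite -ex => ez; rewrite -ex in x'S.
  by rewrite -(opK x y) // ez opK.
pose B3 := [set p in setX S S | op p.1 p.2 \notin N p.2].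
have leB3 : #|B3| <= #|B|.
  rewrite -(card_in_imset (f := fun p => (p.2, op p.1 p.2))).
    apply: subset_leq_card; apply/subsetP => _ /imsetP[p + ->].
    rewrite inE inX => /andP[/andP[xS yS] xz].
    by rewrite inE inX /= yS opS.
  move=> [x y] [x' y']; rewrite inE inX => /andP[/andP[/= xS yS] _].
  rewrite inE inX => /andP[/andP[/= x'S y'S] _] [ey]; rewrite -ey => ez; rewrite -ey in y'S.
  have ez' : op y x = op y x' by rewrite !(opC y).
  by rewrite -(opK y x) // ez' opK.
exists #|P|; last first.
  have : #|setX S S| <= #|G :|: B :|: B2 :|: B3|.
    apply: subset_leq_card; apply/subsetP => p pS.
    rewrite !in_setU [p \in G]inE [p \in B]inE [p \in B2]inE [p \in B3]inE pS /=.
    by case: (p.2 \in _); case: (op _ _ \in N p.1); case: (op _ _ \in N p.2).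
  have := leq_card_setU (G :|: B :|: B2) B3; have := leq_card_setU (G :|: B) B2.
  have := leq_card_setU G B; rewrite cardsX -mulnn => -[+ _] [+ _] [+ _]; lia.
rewrite cardE; apply: packable_family; first exact: enum_uniq.
  by move=> K; rewrite mem_enum => /imsetP[p pG ->]; rewrite tri3 ?triF.
move=> K K'; rewrite !mem_enum => /imsetP[p pG ->] /imsetP[q qG ->].
apply: contraNT => /pred0Pn[A /andP[/= /pairsP[u [v [-> nuv up vp]]]]].
rewrite inE subUset !sub1set => /andP[/andP[uq vq] _].
by rewrite (triE p u v) // -(triE q u v).
Qed.

End NearComplete.

(** * The packing estimate *)

Section Induction.
Variables (R : realFieldType) (T : finType).
Implicit Types (F G L : {set {set T}}) (K S U A : {set T}).
Local Open Scope ring_scope.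

(** Deleting [x] lowers a |S|^2 by 2 a |S| - a and removes at most deg x + |s| C(r,2) edges, so the
    second alternative is the increment of the claimed bound. The first alternative ends the
    induction at once. *)
Lemma pack_induction r (a c w C : R) : (1 < r)%N -> 0 <= c ->
  (forall S F, F \subset pairs S -> S != set0 ->
     (exists2 k, packable r.+1 F k &
        (1 + c) * (#|F|%:R - a * #|S|%:R ^+ 2) <= w * k%:R + C * #|S|%:R)
     \/ exists x (s : seq {set T}), [/\ x \in S,
        pairwise (fun K K' => [disjoint K & K']) s,
        forall K, K \in s -> [/\ #|K| = r, K \subset nbr F x & pairs K \subset F] &
        (1 + c) * (#|nbr F x|%:R - 2 * a * #|S|%:R + a + (size s)%:R * 'C(r, 2)%:R)
          <= w * (size s)%:R + C]) ->
  forall S F, F \subset pairs S -> exists2 k, packable r.+1 F k &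
    (1 + c) * (#|F|%:R - a * #|S|%:R ^+ 2) <= w * k%:R + C * #|S|%:R.
Proof.
move=> r1 c0 step S; have [n] := ubnP #|S|; elim: n S => // n IH S Sn F FS.
have F2 A : A \in F -> #|A| = 2 by move=> /(subsetP FS); rewrite inE => /andP[_ /eqP].
have [S0|S0] := eqVneq S set0.
  exists 0%N; first by exists F; exact: pack0.
  have -> : F = set0.
    apply/eqP; rewrite -subset0; apply/subsetP => A AF; have := subsetP FS _ AF.
    by rewrite S0 inE subset0 => /andP[/eqP->]; rewrite cards0.
  by rewrite S0 !cards0; lra.
have [//|[x [s [xS pws sF ineq]]]] := step S F FS S0.
have awayS : away F x s \subset pairs (S :\ x).
  apply/subsetP => A; rewrite inE => /and3P[AF xA _].
  have := subsetP FS _ AF; rewrite !inE => /andP[AS ->]; rewrite andbT.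
  by rewrite subsetD1 AS.
have cS : #|S| = #|S :\ x|.+1 by rewrite (cardsD1 x S) xS.
have [|k pk kineq] := IH (S :\ x) _ _ awayS; first by rewrite -ltnS -cS.
exists (size s + k)%N; first exact: pack_step FS r1 pws sF pk.
have : (#|F| <= #|away F x s| + #|nbr F x| + size s * 'C(r, 2))%N.
  by apply: card_away => // K /sF[].
rewrite -(ler_nat R) !natrD natrM => cF.
have := ler_wpM2l (addr_ge0 ler01 c0) cF.
rewrite cS -natr1 in ineq *.
move: ineq kineq; set e := #|away F x s|%:R; set N := #|S :\ x|%:R; nra.
Qed.

Lemma min_degree F S : S != set0 -> F \subset pairs S ->
  exists x, x \in S /\ (#|nbr F x| <= #|S|)%N /\
    forall v, v \in S -> (#|S :\: nbr F v| <= #|S| - #|nbr F x|)%N.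
Proof.
move=> /set0Pn[x0 x0S] FS.
have [x xS xmin] := arg_minnP (fun v => #|nbr F v|) x0S; exists x; split=> //; split.
  exact: subset_leq_card (nbr_sub _ FS).
move=> v vS; rewrite cardsD (setIidPr (nbr_sub v FS)) leq_sub2l //; exact: xmin.
Qed.

End Induction.

(** * The packing estimate for triangles and for larger cliques *)

Section PackBound.
Variable R : realFieldType.
Local Open Scope ring_scope.

Definition pack_bound r (a c w C : R) := forall (T : finType) (S : {set T}) (F : {set {set T}}),
  F \subset pairs S ->
  exists2 k, packable r F k &
    (1 + c) * (#|F|%:R - a * #|S|%:R ^+ 2) <= w * k%:R + C * #|S|%:R.

(* The weight is chosen so that c (1 + C(r, 2)) = 1: the surplus r - 1 - c C(r, 2) per clique
   is then at least 1 + c. *)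
Lemma pack_bound_ge4 r : (3 <= r)%N ->
  pack_bound r.+1 (r.-1%:R / (2 * r%:R)) ('C(r, 2).+1%:R^-1) ('C(r.+1, 2)%:R - 1) 4.
Proof.
move=> r3; set a := _ / _; set c := _^-1; set B := 'C(r, 2)%:R : R.
have r0 : 0 < r%:R :> R by rewrite ltr0n; lia.
have B0 : 0 <= B by exact: ler0n.
have cB : c * (B + 1) = 1 by rewrite natr1 mulVf // pnatr_eq0.
have c0 : 0 <= c by rewrite invr_ge0 ler0n.
have pr : r.-1%:R = r%:R - 1 :> R by rewrite -[in RHS](@prednK r) -?natr1 ?addrK //; lia.
have ar : 2 * a * r%:R = r%:R - 1 by rewrite /a pr; field; rewrite gt_eqF.
have wE : 'C(r.+1, 2)%:R - 1 = B + r%:R - 1 by rewrite binS bin1 natrD.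
move=> T; apply: pack_induction => //; first lia.
move=> S F FS S0; right.
have [x [xS [xd xmin]]] := min_degree S0 FS.
set d := #|nbr F x| in xd xmin *; set n := #|S| in xd xmin *.
(* The floor of the excess d - (1 - 1/r) n, and 0 when the excess is negative. It is chosen to meet
   the greedy condition j r + (r-1)(n-d) < d + r. *)
pose j := ((r * d - r.-1 * n) %/ r)%N.
have [l [lj pwl lP]] : exists l : seq {set T}, [/\ size l = j,
    pairwise (fun K K' : {set T} => [disjoint K & K']) l &
    forall K : {set T}, K \in l -> [/\ #|K| = r, K \subset nbr F x & pairs K \subset F]].
  have [->|j0] := posnP j; first by exists [::].
  have := @greedy_cliques _ F (n - d) r.-1 j (nbr F x); rewrite prednK; last lia.
  apply.
    move=> v vx; have vS := subsetP (nbr_sub x FS) v vx.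
    by apply: leq_trans (xmin v vS); apply: subset_leq_card; apply: setSD; exact: nbr_sub.
  have jr : (j * r <= r * d - r.-1 * n)%N by exact: leq_trunc_div.
  have : (0 < j * r)%N by rewrite muln_gt0 j0; lia.
  rewrite -/d mulnBr; case: (r) r3 jr => //= q _; nia.
exists x, l; split=> //; rewrite lj.
have : (r * d <= r.-1 * n + r * j.+1)%N.
  have := ltn_ceil (r * d - r.-1 * n) (_ : 0 < r)%N; rewrite -/j => /(_ ltac:(lia)); lia.
rewrite -(ler_nat R) natrD !natrM -natr1 -/B wE pr => H.
have J0 : 0 <= j%:R :> R by exact: ler0n.
move: (d%:R) (n%:R) (j%:R) H J0 => D N J H J0.
have H' : D - 2 * a * N <= J + 1.
  have : r%:R * (D - 2 * a * N) <= r%:R * (J + 1).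
    have := congr1 ( *%R^~ N) ar => /= arN.
    by move: H; rewrite mulrBl mul1r in arN; rewrite mulrBr mulrBl mulrDr mulr1; lra.
  by rewrite ler_pM2l.
(* By [cB] and [H'] the left side is at most (B + 2) J + (1 + c)(1 + a); here B + 2 <= B + r - 1,
   and [c], [a] at most 1 bound the constant by 4. *)
have r3' : 3 <= r%:R :> R by rewrite (ler_nat _ 3).
have c1 : c <= 1 by nra.
have a1 : a <= 1 by nra.
nra.
Qed.

(* A matching of size (d - 1) / 2 in a neighbourhood of size d pays off as long as
   (1 + 3c) d <= (1 + c) n; for c = 1/30 this covers d <= 15 n / 16. *)
Lemma pack_bound_3 : pack_bound 3 (1 / 4) (30^-1) 2 4.
Proof.
move=> T; apply: pack_induction => //; first by rewrite invr_ge0 ler0n.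
move=> S F FS S0; have [x [xS [xd xmin]]] := min_degree S0 FS.
set d := #|nbr F x| in xd xmin *; set n := #|S| in xd xmin *.
have [dn|nd] := leqP (16 * d) (15 * n); last first.
  left; have [k pk kn] := near_complete FS xmin; exists k => //.
  have eF : (2 * #|F| <= n ^ 2)%N.
    have := subset_leq_card FS; rewrite card_pairs bin2 -/n.
    have : ((n * n.-1)./2.*2 <= n * n.-1)%N by rewrite -[leqRHS]odd_double_half leq_addl.
    have : (n * n.-1 <= n * n)%N by rewrite leq_mul2l leq_pred orbT.
    lia.
  (* Here n - d < n/16, so at least 13/16 of n^2/6 triangles are found. This suffices because
     (31/30)/4 < 2 * 13/96. *)
  have kn' : (13 * n ^ 2 <= 96 * k)%N.
    have : (n * (16 * (n - d)) <= n * n)%N by rewrite leq_mul2l; apply/orP; right; lia.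
    by rewrite -/n -/d -mulnn in kn *; lia.
  move: eF kn'; rewrite -mulnn -!(ler_nat R) !natrM -expr2 => eF kn'.
  have := ler0n R n; have := sqr_ge0 (n%:R : R); lra.
(* A vertex of the neighbourhood misses at most n - d vertices, so it has at least 2d - n neighbours
   among the [d]; truncation gives [j] = 0 when 2d < n. *)
right; pose j := minn (2 * d - n) (d %/ 2).
have [|||l [lj pwl lP]] := @matching _ F (nbr F x) (2 * d - n) j.
- move=> v vx; have vS := subsetP (nbr_sub x FS) v vx.
  have := xmin v vS; have := cardsID (nbr F v) (nbr F x).
  have : (#|nbr F x :\: nbr F v| <= #|S :\: nbr F v|)%N.
    by apply: subset_leq_card; apply: setSD; exact: nbr_sub.
  rewrite -/d -/n; lia.
- exact: geq_minl.
- have := geq_minr (2 * d - n) (d %/ 2); rewrite -/d -/j; lia.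
exists x, l; split=> //; rewrite lj -/d -/n binn.
(* If 2d - n <= j, the estimate follows from (3/2)(1 + c) < 2. Otherwise d <= 2j + 1, the 1 being
   rounding, and [dn] is what makes it work. *)
have : (2 * d - n <= j)%N || (d <= 2 * j + 1)%N by rewrite /j /minn; case: ifP; lia.
have J0 : 0 <= j%:R :> R by exact: ler0n.
move: dn; rewrite -(ler_nat R) !natrM => dn.
case/orP; [rewrite leq_subLR|]; rewrite -(ler_nat R) natrD natrM => H; lra.
Qed.

Lemma pack_bound_ex r : (2 <= r)%N -> exists c C : R, [/\ 0 < c, 0 <= C &
  pack_bound r.+1 (r.-1%:R / (2 * r%:R)) c ('C(r.+1, 2)%:R - 1) C].
Proof.
rewrite leq_eqVlt => /predU1P[<-|r3].
  exists 30^-1, 4; split=> //; first by rewrite invr_gt0 ltr0n.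
  move=> T S F FS; have [k pk kn] := pack_bound_3 FS.
  exists k => //; apply: le_trans (_ : _ <= 2 * k%:R + 4 * #|S|%:R) _; last first.
    by rewrite -[3%N]/(3%N) (_ : 'C(3, 2)%:R - 1 = 2) //; rewrite (_ : 'C(3, 2) = 3)%N //; lra.
  by apply: le_trans kn; rewrite (_ : 2.-1%:R / _ = 1 / 4) //=; lra.
exists ('C(r, 2).+1%:R^-1), 4; split=> //; last exact: pack_bound_ge4.
by rewrite invr_gt0 ltr0n.
Qed.

End PackBound.

(** * Stability *)

(** An edge inside a class is a monochromatic edge of [L] or lies in [F :\: L]. The latter set is
    charged in full to every class; the factor [q.+1] is harmless once few edges are removed. *)
Lemma partition_of_coloring (T : finType) (F L : {set {set T}}) q (f : T -> nat) :
  L \subset F -> (forall A, A \in F -> #|A| = 2) -> (forall x, f x <= q) ->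
  exists V : 'I_q.+1 -> {set T},
    [/\ \bigcup_i V i = [set: T], forall i j, i != j -> [disjoint V i & V j] &
        (\sum_i #|[set A in F | A \subset V i]|).*2 <=
          mono L setT f + (q.+1 * #|F :\: L|).*2].
Proof.
move=> LF F2 fq; pose h x : 'I_q.+1 := inord (f x).
have hE x y : (h y == h x) = (f y == f x).
  by rewrite -val_eqE /= !inordK ?ltnS.
exists (fun i => [set x | h x == i]); split.
- by apply/setP => x; rewrite inE; apply/bigcupP; exists (h x); rewrite ?inE.
- move=> i j nij; rewrite -setI_eq0; apply/eqP/setP => x; rewrite !inE.
  by apply: contra_neqF nij => /andP[/eqP-> /eqP->].
have monoE : mono L setT f = (\sum_i #|[set A in L | A \subset [set x | h x == i]]|).*2.
  rewrite /mono (partition_big h xpredT) //= -muln2 big_distrl /=; apply: eq_bigr => i _.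
  rewrite muln2 -sum_nbr_in => [|A /(subsetP LF)/F2//].
  apply: eq_big => [x|x]; rewrite !inE // => /eqP hx.
  by apply: eq_card => y; rewrite !inE andbT -hE hx.
rewrite monoE -doubleD leq_double.
have -> : q.+1 * #|F :\: L| = \sum_(i < q.+1) #|F :\: L| by rewrite sum_nat_const card_ord.
rewrite -big_split.
apply: leq_sum => i _ /=; apply: leq_trans (leq_card_setU _ _).
apply: subset_leq_card; apply/subsetP => A; rewrite !inE.
by move=> /andP[-> ->]; rewrite !andbT orbN.
Qed.

(** * Combining the estimates and choosing the constants *)

Local Open Scope ring_scope.

(** [X] stands for the extremal number, [P] for phi, [E] for e(G), [l] for the leftover edges, [k]
    for the cliques, [M] for the monochromatic edges, [S] for the edges inside classes. With d = n +
    e n^2, the bounds on [P] give E - a n^2 >= (B-1) k - d; against the packing estimate this yields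
    c k <= (1 + c + C) d. Then M <= k + d. *)
Lemma stability_arith (R : realFieldType) (a c C B q e n E l k X P M S : R) :
  0 < c -> 0 <= C -> 2 <= B -> 0 <= q -> 0 <= e -> 0 <= n -> 0 <= k ->
  a * n ^+ 2 <= X + n -> X - e * n ^+ 2 <= P -> P <= l + k -> E = l + B * k ->
  (1 + c) * (E - a * n ^+ 2) <= (B - 1) * k + C * n ->
  l + M <= a * n ^+ 2 -> S <= M + q * B * k ->
  S <= ((1 + q * B) * ((1 + c + C) / c) + 1) * (n + e * n ^+ 2).
Proof.
move=> c0 C0 B2 q0 e0 n0 k0 hX hP hPk hE hpack hM hS.
have en0 : 0 <= e * n ^+ 2 by rewrite mulr_ge0 ?sqr_ge0.
set d := n + e * n ^+ 2; have nd : n <= d by rewrite /d; lra.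
have ck : c * k <= (1 + c + C) * d.
  have h1 : (B - 1) * k - d <= E - a * n ^+ 2 by rewrite hE /d; lra.
  have h2 : (1 + c) * ((B - 1) * k - d) <= (B - 1) * k + C * n.
    by apply: le_trans hpack; rewrite ler_pM2l; lra.
  have h3 : C * n <= C * d by rewrite ler_wpM2l.
  have h4 : c * k <= c * ((B - 1) * k).
    by rewrite ler_pM2l // ler_peMl //; lra.
  lra.
have kd : k <= (1 + c + C) / c * d.
  by rewrite mulrAC ler_pdivlMr // mulrC.
have : (1 + q * B) * k <= (1 + q * B) * ((1 + c + C) / c * d).
  by rewrite ler_wpM2l // addr_ge0 // mulr_ge0 //; lra.
have : M <= k + d by rewrite /d; lra.
rewrite mulrDl mul1r -mulrA; lra.
Qed.

Theorem proposition11 (R : realType) (r : nat) (hr : (3 <= r)%N)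
    (gamma : R) (hgamma : 0 < gamma) :
  exists (eps : R) (n0 : nat),
    0 < eps /\
    forall (n : nat) (T : finType) (G : sgraph T),
      (n0 <= n)%N -> #|T| = n ->
      (extremal_number n (complete r))%:R - eps * n%:R ^+ 2 <= (phi G (complete r))%:R :> R ->
      exists V : 'I_r.-1 -> {set T},
        [/\ \bigcup_i V i = [set: T],
            forall i j, i != j -> [disjoint V i & V j] &
            (\sum_i edges_in G (V i))%:R < gamma * n%:R ^+ 2].
Proof.
case: r hr => // -[|q] //; rewrite !ltnS => q1.
have [c [C [c0 C0 pb]]] := pack_bound_ex R (q1 : 2 <= q.+1)%N.
pose B : R := 'C(q.+2, 2)%:R.
have B2 : 2 <= B.
  have : (2 <= 'C(q.+2, 2))%N by rewrite binS bin1; lia.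
  by rewrite -(ler_nat R).
pose Q := (1 + q.+1%:R * B) * ((1 + c + C) / c) + 1.
have Q0 : 0 < Q.
  rewrite ltr_wpDl // mulr_ge0 ?divr_ge0 ?addr_ge0 ?mulr_ge0 ?ler0n // ?ltW //; lra.
(* For n > 1/eps the error n + eps n^2 is at most 2 eps n^2, so the final bound is (gamma / 2)
   n^2. *)
pose eps := gamma / (4 * Q).
have eps0 : 0 < eps by rewrite divr_gt0 // mulr_gt0.
have epsQ : Q * eps = gamma / 4 by rewrite /eps; field; rewrite gt_eqF.
exists eps, (Num.bound eps^-1); split=> // n T G nn0 Tn hphi.
have nbig : 1 < eps * n%:R.
  rewrite -ltr_pdivrMl // mulr1; apply: (@lt_le_trans _ _ (Num.bound eps^-1)%:R).
    by apply: archi_boundP; rewrite invr_ge0 ltW.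
  by rewrite ler_nat.
have npos : 0 < n%:R :> R by rewrite -(pmulr_rgt0 _ eps0); lra.
have F2 A : A \in edges G -> #|A| = 2.
  by move=> /(forall_inP (edges_card2 G)) /eqP.
have FT : edges G \subset pairs [set: T].
  by apply/subsetP => A /F2 A2; rewrite inE subsetT A2.
have [k0 [L0 FL0] k0P] := pb T [set: T] (edges G) FT.
(* Saturating only increases the number of cliques, so the packing estimate survives, and it makes
   [L] clique-free. *)
have [k [L [FL k0k noK]]] := pack_saturate (isT : 1 < q.+2)%N FL0.
have LF := pack_sub FL.
have [|f [fq Lmono]] := @clique_coloring T L q [set: T].
  by move=> K _; exact: noK.
have [V [VT Vd Vsum]] := partition_of_coloring LF F2 (fun x => fq x (in_setT x)).
exists V; split=> //.
have FLk : #|edges G :\: L| = ('C(q.+2, 2) * k)%N.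
  have := cardsID L (edges G); rewrite (setIidPr LF) (pack_card FL); lia.
pose a : R := q%:R / (2 * q.+1%:R).
have qpos : 0 < q.+1%:R :> R by rewrite ltr0n.
have aq : 2 * q.+1%:R * a = q%:R by rewrite /a; field; rewrite addrC natr1 gt_eqF.
have hX : a * n%:R ^+ 2 <= (extremal_number n (complete q.+2))%:R + n%:R.
  have := turan_lower n (isT : 0 < q.+1)%N; rewrite -mul2n -mulnn /=.
  rewrite -(ler_nat R) !(natrD, natrM) -expr2 -aq => h.
  by rewrite -(@ler_pM2l _ (2 * q.+1%:R)) ?mulr_gt0 //; nra.
have hPk : (phi G (complete q.+2))%:R <= #|L|%:R + k%:R :> R.
  by rewrite -natrD ler_nat; exact: phi_le_pack FL.
have hE : #|edges G|%:R = #|L|%:R + B * k%:R :> R.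
  by rewrite (pack_card FL) natrD natrM.
have hpack : (1 + c) * (#|edges G|%:R - a * n%:R ^+ 2) <= (B - 1) * k%:R + C * n%:R.
  rewrite cardsT Tn in k0P; apply: le_trans k0P _; rewrite lerD2r ler_wpM2l ?ler_nat //.
  by rewrite -/B; lra.
have hM : #|L|%:R + (mono L [set: T] f)%:R / 2 <= a * n%:R ^+ 2.
  move: Lmono; rewrite cardsT Tn -mulnn.
  rewrite sum_nbr_in => [|A /(subsetP LF)/F2//].
  rewrite (_ : [set A in L | A \subset [set: T]] = L); last first.
    by apply/setP => A; rewrite !inE subsetT andbT.
  rewrite -mul2n -(ler_nat R) !(natrD, natrM) -expr2 -aq => h.
  by rewrite -(@ler_pM2l _ (2 * q.+1%:R)) ?mulr_gt0 //; lra.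
have hS : (\sum_i edges_in G (V i))%:R <= (mono L [set: T] f)%:R / 2 + q.+1%:R * B * k%:R.
  have : ((\sum_i edges_in G (V i)).*2 <=
          mono L [set: T] f + (q.+1 * ('C(q.+2, 2) * k)).*2)%N by rewrite -FLk.
  by rewrite -!mul2n -(ler_nat R) natrD !natrM -/B; lra.
have := stability_arith c0 C0 B2 (ltW qpos) (ltW eps0) (ltW npos) (ler0n R k)
  hX hphi hPk hE hpack hM hS.
rewrite -/Q => /le_lt_trans; apply.
have : n%:R <= eps * n%:R ^+ 2 by rewrite expr2 mulrA ler_peMl // ltW.
move=> ne; apply: (@le_lt_trans _ _ (Q * (2 * (eps * n%:R ^+ 2)))).
  by rewrite ler_pM2l //; lra.
have -> : Q * (2 * (eps * n%:R ^+ 2)) = 2 * (Q * eps) * n%:R ^+ 2 by ring.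
have := mulr_gt0 hgamma (exprn_gt0 2 npos); rewrite epsQ; lra.
Qed.
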